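(* There exists a one-to-one correspondence between strict isomorphism classes of strict 3-Lie2Der pairs and equivalence classes of crossed modules of 3-LieDer pairs.
   Context: Throughout, $\mathbb F$ is an algebraically closed field of characteristic $0$ and all vector spaces are finite-dimensional over $\mathbb F$. A 3-Lie algebra is a vector space $L$ with a skew-symmetric trilinear map $[\cdot,\cdot,\cdot]_L$ satisfying $[x_1,x_2,[x_3,x_4,x_5]]=[[x_1,x_2,x_3],x_4,x_5]+[x_3,[x_1,x_2,x_4],x_5]+[x_3,x_4,[x_1,x_2,x_5]]$. A derivation is a linear map $\theta_L:L\to L$ with $\theta_L[x,y,z]=[\theta_L x,y,z]+[x,\theta_L y,z]+[x,y,\theta_L z]$. A 3-LieDer pair $(L,\theta_L)$ is a 3-Lie algebra with a derivation; morphisms of 3-LieDer pairs are 3-Lie algebra morphisms commuting with the derivations. A representation $(V;\rho,\theta_V)$ of $(L,\theta_L)$ consists of a vector space $V$, a linear map $\rho:\wedge^2L\to\mathrm{End}(V)$ and $\theta_V\in\mathrm{End}(V)$ with $\rho(x_1,x_2)\rho(x_3,x_4)=\rho([x_1,x_2,x_3],x_4)+\rho(x_3,[x_1,x_2,x_4])+\rho(x_3,x_4)\rho(x_1,x_2)$, $\rho(x_1,[x_2,x_3,x_4])=\rho(x_3,x_4)\rho(x_1,x_2)-\rho(x_2,x_4)\rho(x_1,x_3)+\rho(x_2,x_3)\rho(x_1,x_4)$, and $\theta_V\rho(x,y)-\rho(x,y)\theta_V=\rho(\theta_Lx,y)+\rho(x,\theta_Ly)$. A strict 3-Lie 2-algebra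 $(V_1,V_0,d,l_3,0)$ (a 3-Lie 2-algebra whose 5-ary operation $l_5:(\wedge^2V_0)\otimes(\wedge^3V_0)\to V_1$ is zero) consists of a complex $V_1\xrightarrow{d}V_0$ and completely skew-symmetric trilinear maps $l_3:V_i\times V_j\times V_k\to V_{i+j+k}$ ($0\le i+j+k\le1$) such that for $x,y,x_i\in V_0$, $u,v,w\in V_1$: (a) $dl_3(x,y,u)=l_3(x,y,du)$; (b) $l_3(u,v,w)=0$, $l_3(u,v,x)=0$; (c) $l_3(du,v,x)=l_3(u,dv,x)$; (d) $0=l_3(l_3(x_1,x_2,x_3),x_4,x_5)+l_3(x_3,l_3(x_1,x_2,x_4),x_5)+l_3(x_3,x_4,l_3(x_1,x_2,x_5))-l_3(x_1,x_2,l_3(x_3,x_4,x_5))$; (e) $0=l_3(l_3(u,x_2,x_3),x_4,x_5)+l_3(x_3,l_3(u,x_2,x_4),x_5)+l_3(x_3,x_4,l_3(u,x_2,x_5))-l_3(u,x_2,l_3(x_3,x_4,x_5))$; (f) $0=l_3(l_3(x_1,x_2,u),x_4,x_5)+l_3(u,l_3(x_1,x_2,x_4),x_5)+l_3(u,x_4,l_3(x_1,x_2,x_5))-l_3(x_1,x_2,l_3(u,x_4,x_5))$. A strict 2-derivation of it is $(X_0,X_1,0)$ with $X_0\in\mathrm{End}(V_0)$, $X_1\in\mathrm{End}(V_1)$ such that $X_0\circ d=d\circ X_1$; $X_0l_3(x,y,z)=l_3(X_0x,y,z)+l_3(x,X_0y,z)+l_3(x,y,X_0z)$; $X_1l_3(x,y,v)=l_3(X_0x,y,v)+l_3(x,X_0y,v)+l_3(x,y,X_1v)$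 for $x,y,z\in V_0$, $v\in V_1$. A strict 3-Lie2Der pair is a strict 3-Lie 2-algebra with a strict 2-derivation. A strict isomorphism $(f_0,f_1,0,0)$ between strict 3-Lie2Der pairs $((V_1,V_0,d,l_3,0);(X_0,X_1,0))$ and $((V_1',V_0',d',l_3',0);(X_0',X_1',0))$ consists of invertible linear maps $f_0:V_0\to V_0'$, $f_1:V_1\to V_1'$ such that for $x,y,z\in V_0$, $v\in V_1$: $f_0\circ d=d'\circ f_1$, $f_0(l_3(x,y,z))=l_3'(f_0x,f_0y,f_0z)$, $f_1(l_3(x,y,v))=l_3'(f_0x,f_0y,f_1v)$, $X_0'\circ f_0=f_0\circ X_0$, $X_1'\circ f_1=f_1\circ X_1$. A crossed module of 3-LieDer pairs is a quadruple $((A,\theta_A),(B,\theta_B),(A;\rho,\theta_A),\eta)$ where $(A,\theta_A)$, $(B,\theta_B)$ are 3-LieDer pairs, $(A;\rho,\theta_A)$ is a representation of $(B,\theta_B)$, and $\eta:(A,\theta_A)\to(B,\theta_B)$ is a morphism of 3-LieDer pairs such that for $u,v,w\in A$, $x,y\in B$: $\eta(\rho(x,y)(u))=[x,y,\eta(u)]_B$; $\rho(\eta(u),\eta(v))(w)=[u,v,w]_A$; $\rho(x,\eta(u))(v)=-\rho(x,\eta(v))(u)$; $\rho(x,y)[u,v,w]_A=[\rho(x,y)(u),v,w]_A+[u,\rho(x,y)(v),w]_A+[u,v,\rho(x,y)(w)]_A$. Two crossed modules $((A,\theta_A),(B,\theta_B),(A;\rho,\theta_A),\eta)$ and $((A',\theta_{A'}),(B',\theta_{B'}),(A';\rho',\theta_{A'}),\eta')$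 are equivalent if there are 3-LieDer pair isomorphisms $\sigma:(B,\theta_B)\to(B',\theta_{B'})$ and $\tau:(A,\theta_A)\to(A',\theta_{A'})$ with $\sigma\circ\eta=\eta'\circ\tau$ and $\tau\circ\rho(x,y)\circ\tau^{-1}=\rho'(\sigma(x),\sigma(y))$ for all $x,y\in B$. *)

(* Defs.v *)
From HB Require Import structures.
From mathcomp Require Import all_boot all_order all_algebra.

Set Implicit Arguments.
Unset Strict Implicit.
Unset Printing Implicit Defensive.

Import GRing.Theory.
Local Open Scope ring_scope.

Section Structures.
Variable F : fieldType.

Definition trilinear (U V W Z : vectType F) (m : U -> V -> W -> Z) : Prop :=
  [/\ forall y z, linear (fun x => m x y z),
      forall x z, linear (fun y => m x y z)
    & forall x y, linear (fun z => m x y z)].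

Record threeLie := ThreeLie {
  tl_space :> vectType F;
  bracket : tl_space -> tl_space -> tl_space -> tl_space;
  bracket_trilinear : trilinear bracket;
  bracket_skew12 : forall x y z, bracket x y z = - bracket y x z;
  bracket_skew23 : forall x y z, bracket x y z = - bracket x z y;
  bracket_fundamental : forall x1 x2 x3 x4 x5,
    bracket x1 x2 (bracket x3 x4 x5) =
      bracket (bracket x1 x2 x3) x4 x5 + bracket x3 (bracket x1 x2 x4) x5
      + bracket x3 x4 (bracket x1 x2 x5)
}.

Definition is_derivation (L : threeLie) (theta : 'End(L)) : Prop :=
  forall x y z : L,
    theta (bracket x y z) =
      bracket (theta x) y z + bracket x (theta y) z + bracket x y (theta z).

Record threeLieDer := ThreeLieDer {
  tld_lie :> threeLie;
  theta : 'End(tld_lie);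
  theta_derivation : is_derivation theta
}.

Definition is_lieder_morphism (L L' : threeLieDer) (f : 'Hom(L, L')) : Prop :=
  (forall x y z : L, f (bracket x y z) = bracket (f x) (f y) (f z)) /\
  (f \o theta L = theta L' \o f)%VF.

Definition is_lieder_isomorphism (L L' : threeLieDer) (f : 'Hom(L, L')) : Prop :=
  is_lieder_morphism f /\ bijective f.

(** A linear map out of the exterior square of [L] is encoded as a
    skew-symmetric bilinear map on [L]. *)
Record is_representation (L : threeLieDer) (V : vectType F)
    (rho : L -> L -> 'End(V)) (thetaV : 'End(V)) : Prop := IsRepresentation {
  rho_linear_l : forall y, linear (fun x => rho x y);
  rho_linear_r : forall x, linear (fun y => rho x y);
  rho_skew : forall x y, rho x y = - rho y x;
  rho_comp : forall x1 x2 x3 x4,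
    (rho x1 x2 \o rho x3 x4)%VF =
      rho (bracket x1 x2 x3) x4 + rho x3 (bracket x1 x2 x4)
      + (rho x3 x4 \o rho x1 x2)%VF;
  rho_bracket : forall x1 x2 x3 x4,
    rho x1 (bracket x2 x3 x4) =
      (rho x3 x4 \o rho x1 x2)%VF - (rho x2 x4 \o rho x1 x3)%VF
      + (rho x2 x3 \o rho x1 x4)%VF;
  rho_theta : forall x y,
    (thetaV \o rho x y)%VF - (rho x y \o thetaV)%VF =
      rho (theta L x) y + rho x (theta L y)
}.

(** [l000], [l001], [l010], [l100] are the components
    [V_i x V_j x V_k -> V_(i+j+k)] of [l_3] with [i + j + k <= 1].  The
    components of total degree 2 and 3 land in [V_2 = V_3 = 0], so that
    [l_3(u,v,x) = 0] and [l_3(u,v,w) = 0] need no field.  Complete skew-symmetry is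
    expressed on the two adjacent transpositions, which exchange the mixed
    components among themselves. *)
Record strict2Lie := Strict2Lie {
  V1 : vectType F;
  V0 : vectType F;
  dd : 'Hom(V1, V0);
  l000 : V0 -> V0 -> V0 -> V0;
  l001 : V0 -> V0 -> V1 -> V1;
  l010 : V0 -> V1 -> V0 -> V1;
  l100 : V1 -> V0 -> V0 -> V1;
  l000_trilinear : trilinear l000;
  l001_trilinear : trilinear l001;
  l010_trilinear : trilinear l010;
  l100_trilinear : trilinear l100;
  l000_skew12 : forall x y z, l000 x y z = - l000 y x z;
  l000_skew23 : forall x y z, l000 x y z = - l000 x z y;
  l001_skew12 : forall x y u, l001 x y u = - l001 y x u;
  l001_skew23 : forall x y u, l001 x y u = - l010 x u y;
  l010_skew12 : forall x u y, l010 x u y = - l100 u x y;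
  l100_skew23 : forall u x y, l100 u x y = - l100 u y x;
  s2l_a : forall x y u, dd (l001 x y u) = l000 x y (dd u);
  s2l_c : forall u v x, l010 (dd u) v x = l100 u (dd v) x;
  s2l_d : forall x1 x2 x3 x4 x5,
    0 = l000 (l000 x1 x2 x3) x4 x5 + l000 x3 (l000 x1 x2 x4) x5
        + l000 x3 x4 (l000 x1 x2 x5) - l000 x1 x2 (l000 x3 x4 x5);
  s2l_e : forall u x2 x3 x4 x5,
    0 = l100 (l100 u x2 x3) x4 x5 + l010 x3 (l100 u x2 x4) x5
        + l001 x3 x4 (l100 u x2 x5) - l100 u x2 (l000 x3 x4 x5);
  s2l_f : forall x1 x2 u x4 x5,
    0 = l100 (l001 x1 x2 u) x4 x5 + l100 u (l000 x1 x2 x4) x5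
        + l100 u x4 (l000 x1 x2 x5) - l001 x1 x2 (l100 u x4 x5)
}.

Record is_strict_2derivation (S : strict2Lie)
    (X0 : 'End(V0 S)) (X1 : 'End(V1 S)) : Prop := IsStrict2Derivation {
  s2d_d : (X0 \o dd S = dd S \o X1)%VF;
  s2d_000 : forall x y z : V0 S,
    X0 (l000 x y z) = l000 (X0 x) y z + l000 x (X0 y) z + l000 x y (X0 z);
  s2d_001 : forall (x y : V0 S) (v : V1 S),
    X1 (l001 x y v) = l001 (X0 x) y v + l001 x (X0 y) v + l001 x y (X1 v)
}.

Record strict2LieDer := Strict2LieDer {
  s2ld_alg :> strict2Lie;
  X0 : 'End(V0 s2ld_alg);
  X1 : 'End(V1 s2ld_alg);
  s2ld_derivation : is_strict_2derivation X0 X1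
}.

Record is_strict_isomorphism (S S' : strict2LieDer)
    (f0 : 'Hom(V0 S, V0 S')) (f1 : 'Hom(V1 S, V1 S')) : Prop :=
  IsStrictIsomorphism {
  si_bij0 : bijective f0;
  si_bij1 : bijective f1;
  si_d : (f0 \o dd S = dd S' \o f1)%VF;
  si_000 : forall x y z : V0 S, f0 (l000 x y z) = l000 (f0 x) (f0 y) (f0 z);
  si_001 : forall (x y : V0 S) (v : V1 S),
    f1 (l001 x y v) = l001 (f0 x) (f0 y) (f1 v);
  si_X0 : (X0 S' \o f0 = f0 \o X0 S)%VF;
  si_X1 : (X1 S' \o f1 = f1 \o X1 S)%VF
}.

Definition strictly_isomorphic (S S' : strict2LieDer) : Prop :=
  exists (f0 : 'Hom(V0 S, V0 S')) (f1 : 'Hom(V1 S, V1 S')),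
    is_strict_isomorphism f0 f1.

Record crossedModule := CrossedModule {
  cmA : threeLieDer;
  cmB : threeLieDer;
  rho : cmB -> cmB -> 'End(cmA);
  eta : 'Hom(cmA, cmB);
  cm_representation : is_representation rho (theta cmA);
  cm_morphism : is_lieder_morphism eta;
  cm_equivariant : forall (x y : cmB) (u : cmA),
    eta (rho x y u) = bracket x y (eta u);
  cm_peiffer : forall u v w : cmA, rho (eta u) (eta v) w = bracket u v w;
  cm_skew : forall (x : cmB) (u v : cmA), rho x (eta u) v = - rho x (eta v) u;
  cm_derivation : forall (x y : cmB) (u v w : cmA),
    rho x y (bracket u v w) =
      bracket (rho x y u) v w + bracket u (rho x y v) w
      + bracket u v (rho x y w)
}.

Definition cm_equivalent (C C' : crossedModule) : Prop :=
  exists (sigma : 'Hom(cmB C, cmB C')) (tau : 'Hom(cmA C, cmA C')),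
    [/\ is_lieder_isomorphism sigma,
        is_lieder_isomorphism tau,
        (sigma \o eta C = eta C' \o tau)%VF
      & forall x y : cmB C,
          (tau \o rho x y \o tau^-1)%VF = rho (sigma x) (sigma y)].

(** The dictionary [B = V_0], [A = V_1], [eta = d], [theta_B = X_0],
    [theta_A = X_1], [rho(x,y)(u) = l_3(x,y,u)], [[u,v,w]_A = l_3(du,dv,w)],
    read up to linear identifications of the underlying spaces. *)
Definition corresponds (S : strict2LieDer) (C : crossedModule) : Prop :=
  exists (g0 : 'Hom(V0 S, cmB C)) (g1 : 'Hom(V1 S, cmA C)),
    [/\ bijective g0 /\ bijective g1,
        (g0 \o dd S = eta C \o g1)%VF,
        (g0 \o X0 S = theta (cmB C) \o g0)%VF /\
        (g1 \o X1 S = theta (cmA C) \o g1)%VF,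
        (forall x y z : V0 S,
          g0 (l000 x y z) = bracket (g0 x) (g0 y) (g0 z)) /\
        (forall u v w : V1 S,
          g1 (l001 (dd S u) (dd S v) w) = bracket (g1 u) (g1 v) (g1 w))
      & forall (x y : V0 S) (u : V1 S),
          g1 (l001 x y u) = rho (g0 x) (g0 y) (g1 u)].

End Structures.

Definition classes (T : Type) (R : T -> T -> Prop) : Type :=
  {P : T -> Prop | exists x, P = R x}.

Definition class_of (T : Type) (R : T -> T -> Prop) (x : T) : classes R :=
  exist _ (R x) (ex_intro _ x erefl).

Definition strict_iso_class (F : fieldType) : Type :=
  classes (@strictly_isomorphic F).

Definition crossed_module_class (F : fieldType) : Type :=
  classes (@cm_equivalent F).

(* Main.v *)
Require Import Defs.
From HB Require Import structures.
From mathcomp Require Import all_boot all_order all_algebra.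
From Stdlib Require Import FunctionalExtensionality PropExtensionality.
From Stdlib Require Import ProofIrrelevance.

Set Implicit Arguments.
Unset Strict Implicit.
Unset Printing Implicit Defensive.

Import GRing.Theory.
Local Open Scope ring_scope.

(** A strict 3-Lie2Der pair and a crossed module are the same data written in
    two ways.  Skew-symmetry makes all mixed components of [l_3] equal up to
    sign to [l001], so a pair amounts to the bracket [l000] on [V_0], the
    action [rho x y = l001 x y] on [V_1], the map [d] and the two derivations.
    The identities [s2l_e] and [s2l_f] are then the two representation
    identities of [rho], [s2l_a] is equivariance of [d], and [s2l_c] says that [rho x (d u) v] is
    skew-symmetric in [u] and [v].

    The bracket of [A] in a crossed module is determined by the rest through
    the Peiffer identity [[u,v,w] = rho (eta u) (eta v) w].  Forgetting it loses
    nothing: [pair_of_cm] reads a crossed module as a pair, and a strict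
    isomorphism between pairs of this form preserves the brackets of [A]
    automatically, hence is an equivalence of crossed modules
    ([cm_equivalent_pair_of_cm]).  Conversely the Peiffer formula defines
    a 3-Lie bracket on the [V_1] of any pair, and the resulting crossed module
    reads back as the given pair ([pair_of_cm_of_pair]).

    Thus [pair_of_cm] reflects and preserves the two equivalences and is
    surjective up to strict isomorphism, which gives the bijection on classes
    ([class_bijection]); the relation [corresponds S C] is just strict
    isomorphism of [S] with [pair_of_cm C]. *)

(** * Bijections between sets of classes *)

Lemma classes_eq (T : Type) (R : T -> T -> Prop) (P Q : classes R) :
  (forall x, sval P x <-> sval Q x) -> P = Q.
Proof.
case: P Q => [P hP] [Q hQ] /= PQ.
have {}PQ : P = Q.
  by apply: functional_extensionality => x; apply: propositional_extensionality.
by subst Q; rewrite (proof_irrelevance _ hP hQ).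
Qed.

Section ClassBijection.
Variables (T U : Type) (R : T -> T -> Prop) (E : U -> U -> Prop) (g : U -> T).
Hypothesis R_refl : forall x, R x x.
Hypothesis R_sym : forall x y, R x y -> R y x.
Hypothesis R_trans : forall x y z, R x y -> R y z -> R x z.
Hypothesis E_g : forall y y', E y y' <-> R (g y) (g y').
Hypothesis g_surj : forall x, exists y, R x (g y).

Let pull_subproof (P : classes R) : exists y, (fun y => sval P (g y)) = E y.
Proof.
case: P => P [x defP]; subst P => /=; have [y xy] := g_surj x; exists y.
apply: functional_extensionality => y'; apply: propositional_extensionality.
split=> [xy'|/E_g yy']; last exact: R_trans xy yy'.
by apply/E_g; apply: R_trans xy'; apply: R_sym.
Qed.

Let push_subproof (Q : classes E) :
  exists x, (fun x => exists2 y, sval Q y & R (g y) x) = R x.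
Proof.
case: Q => Q [y defQ]; subst Q => /=; exists (g y).
apply: functional_extensionality => x; apply: propositional_extensionality.
split=> [[y' /E_g yy' y'x]|yx]; first exact: R_trans yy' y'x.
by exists y => //; apply/E_g.
Qed.

Let pull (P : classes R) : classes E := exist _ _ (pull_subproof P).
Let push (Q : classes E) : classes R := exist _ _ (push_subproof Q).

(** The preimage under [g] of an [R]-class is a nonempty [E]-class; taking
    preimages is undone by saturating the image under [g].  Working with
    preimages avoids choosing representatives. *)
Lemma class_bijection :
  exists Phi : classes R -> classes E,
    bijective Phi /\
    forall x y, Phi (class_of R x) = class_of E y <-> R x (g y).
Proof.
exists pull; split.
  exists push.
  - move=> P; case: P => P [x0 defP]; subst P; apply: classes_eq => x /=.
    split=> [[y x0y yx]|x0x]; first exact: R_trans x0y yx.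
    have [y xy] := g_surj x; exists y; first exact: R_trans x0x xy.
    exact: R_sym.
  - move=> Q; case: Q => Q [y0 defQ]; subst Q; apply: classes_eq => y /=.
    split=> [[y' /E_g y0y' y'y]|/E_g y0y]; first by apply/E_g; apply: R_trans y'y.
    by exists y0 => //; apply/E_g.
move=> x y; split=> [xy|xy].
  have /= exy := congr1 (fun Q : classes E => sval Q y) xy.
  by rewrite exy; apply/E_g.
apply: classes_eq => y' /=; split=> [xy'|/E_g yy'].
  by apply/E_g; apply: R_trans xy'; apply: R_sym.
exact: R_trans yy'.
Qed.

End ClassBijection.

(** * Linear maps *)

Section LinearMaps.
Variable F : fieldType.
Implicit Types U V W : vectType F.

Lemma linfun_linearE U V (f : U -> V) : linear f -> linfun f =1 f.
Proof.
move=> lf u.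
pose f' : {linear U -> V} := HB.pack f (GRing.isLinear.Build _ _ _ _ f lf).
exact: (lfunE f' u).
Qed.

Lemma lfun_bijK U V (f : 'Hom(U, V)) :
  bijective f -> cancel f f^-1%VF /\ cancel f^-1%VF f.
Proof.
move=> bf; have fK : cancel f f^-1%VF.
  by apply: lker0_lfunK; apply/lker0P; apply: bij_inj.
by split=> //; apply/(bij_can_sym bf).
Qed.

Lemma lfun_bij_inv U V (f : 'Hom(U, V)) : bijective f -> bijective f^-1%VF.
Proof. by case/lfun_bijK=> fK gK; exists f. Qed.

Lemma lfun_bij_comp U V W (g : 'Hom(V, W)) (f : 'Hom(U, V)) :
  bijective g -> bijective f -> bijective (g \o f)%VF.
Proof.
move=> bg bf; apply: (eq_bij (bij_comp bg bf)) => u.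
by rewrite comp_lfunE.
Qed.

Lemma lfun_eqP U V (f g : 'Hom(U, V)) : f = g <-> f =1 g.
Proof. by split=> [->//|fg]; apply/lfunP. Qed.

Lemma lfun_compP U V V' W (f : 'Hom(U, V)) (g : 'Hom(V, W))
    (f' : 'Hom(U, V')) (g' : 'Hom(V', W)) :
  (g \o f = g' \o f')%VF <-> forall u, g (f u) = g' (f' u).
Proof.
rewrite lfun_eqP; split=> gf u; last by rewrite !comp_lfunE.
by have := gf u; rewrite !comp_lfunE.
Qed.

End LinearMaps.

(** * Strict isomorphism is an equivalence relation *)

Section StrictIsomorphism.
Variable F : fieldType.
Implicit Types S : strict2LieDer F.

Lemma strictly_isomorphic_refl S : strictly_isomorphic S S.
Proof.
exists \1%VF, \1%VF; split; rewrite ?comp_lfun1l ?comp_lfun1r //.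
- by exists id => x; rewrite id_lfunE.
- by exists id => x; rewrite id_lfunE.
- by move=> x y z; rewrite !id_lfunE.
- by move=> x y z; rewrite !id_lfunE.
Qed.

Lemma strictly_isomorphic_sym S S' :
  strictly_isomorphic S S' -> strictly_isomorphic S' S.
Proof.
case=> f0 [f1 [b0 b1 /lfun_compP fd f000 f001 /lfun_compP fX0 /lfun_compP fX1]].
have [f0K g0K] := lfun_bijK b0; have [f1K g1K] := lfun_bijK b1.
exists (f0^-1)%VF, (f1^-1)%VF; split; try exact: lfun_bij_inv.
- by apply/lfun_compP => u; apply: (bij_inj b0); rewrite fd g0K g1K.
- by move=> x y z; apply: (bij_inj b0); rewrite f000 !g0K.
- by move=> x y u; apply: (bij_inj b1); rewrite f001 !g0K !g1K.
- by apply/lfun_compP => x; apply: (bij_inj b0); rewrite -fX0 !g0K.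
- by apply/lfun_compP => u; apply: (bij_inj b1); rewrite -fX1 !g1K.
Qed.

Lemma strictly_isomorphic_trans S S' S'' :
  strictly_isomorphic S S' -> strictly_isomorphic S' S'' ->
  strictly_isomorphic S S''.
Proof.
case=> f0 [f1 [b0 b1 /lfun_compP fd f000 f001 /lfun_compP fX0 /lfun_compP fX1]].
case=> g0 [g1 [c0 c1 /lfun_compP gd g000 g001 /lfun_compP gX0 /lfun_compP gX1]].
exists (g0 \o f0)%VF, (g1 \o f1)%VF; split; try exact: lfun_bij_comp.
- by apply/lfun_compP => u; rewrite !comp_lfunE fd gd.
- by move=> x y z; rewrite !comp_lfunE f000 g000.
- by move=> x y u; rewrite !comp_lfunE f001 g001.
- by apply/lfun_compP => x; rewrite !comp_lfunE gX0 fX0.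
- by apply/lfun_compP => u; rewrite !comp_lfunE gX1 fX1.
Qed.

End StrictIsomorphism.

(** * From crossed modules to strict 3-Lie2Der pairs *)

Section PairOfCrossedModule.
Variables (F : fieldType) (C : crossedModule F).
Local Notation A := (cmA C).
Local Notation B := (cmB C).
Let repC := cm_representation C.

Lemma rho_skewE (x y : B) (u : A) : rho x y u = - rho y x u.
Proof. by rewrite (rho_skew repC) opp_lfunE. Qed.

Lemma rho_compE (x1 x2 x3 x4 : B) (u : A) :
  rho x1 x2 (rho x3 x4 u) =
    rho (bracket x1 x2 x3) x4 u + rho x3 (bracket x1 x2 x4) u
    + rho x3 x4 (rho x1 x2 u).
Proof.
by rewrite -comp_lfunE (rho_comp repC) !add_lfunE comp_lfunE.
Qed.

Lemma rho_bracketE (x1 x2 x3 x4 : B) (u : A) :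
  rho x1 (bracket x2 x3 x4) u =
    rho x3 x4 (rho x1 x2 u) - rho x2 x4 (rho x1 x3 u)
    + rho x2 x3 (rho x1 x4 u).
Proof.
by rewrite (rho_bracket repC) !(add_lfunE, opp_lfunE) !comp_lfunE.
Qed.

Lemma rho_trilinear : trilinear (fun (x y : B) (u : A) => rho x y u).
Proof.
split.
- by move=> y u a x x'; rewrite (rho_linear_l repC) add_lfunE scale_lfunE.
- by move=> x u a y y'; rewrite (rho_linear_r repC) add_lfunE scale_lfunE.
- by move=> x y a u u'; rewrite linearP.
Qed.

Lemma rho_trilinear_first : trilinear (fun (u : A) (x y : B) => rho x y u).
Proof.
have [lx ly lu] := rho_trilinear; split=> [x y|u y|u x].
- exact: lu.
- exact: lx.
- exact: ly.
Qed.

Lemma rho_trilinear_middle : trilinear (fun (x : B) (u : A) (y : B) => - rho x y u).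
Proof.
have [lx ly lu] := rho_trilinear; split=> [u y|x y|x u] a v w /=.
- by rewrite lx opprD scalerN.
- by rewrite lu opprD scalerN.
- by rewrite ly opprD scalerN.
Qed.

(** The mixed components are forced by skew-symmetry: moving the element of
    [A] past one element of [B] costs a sign, so it appears in the middle
    component only. *)
Definition lie2_of_cm : strict2Lie F.
Proof.
refine (@Strict2Lie F A B (Defs.eta C)
  (fun x y z => bracket x y z) (fun x y u => rho x y u)
  (fun x u y => - rho x y u) (fun u x y => rho x y u)
  _ rho_trilinear rho_trilinear_middle rho_trilinear_first
  _ _ _ _ _ _ _ _ _ _ _) => //.
- exact: bracket_trilinear.
- exact: bracket_skew12.
- exact: bracket_skew23.
- exact: rho_skewE.
- by move=> x y u; rewrite opprK.
- by move=> u x y; apply: rho_skewE.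
- by move=> x y u; apply: cm_equivariant.
- by move=> u v x; rewrite -rho_skewE cm_skew -rho_skewE.
- by move=> x1 x2 x3 x4 x5; rewrite (bracket_fundamental x1) subrr.
- by move=> u x2 x3 x4 x5; rewrite (rho_bracketE x2) subrr.
- move=> x1 x2 u x4 x5; apply/esym/eqP.
  by rewrite subr_eq0 (rho_compE x1) [eqbRHS]addrC addrA.
Defined.

(** The compatibility of [theta_A] with [l001] is the identity
    [theta_A rho - rho theta_A = rho (theta_B _) _ + rho _ (theta_B _)] with
    the subtracted term moved to the other side. *)
Lemma lie2_of_cm_derivation :
  @is_strict_2derivation F lie2_of_cm (theta B) (theta A).
Proof.
split=> /=.
- by case: (cm_morphism C) => _ ->.
- exact: theta_derivation.
- move=> x y u; have /lfun_eqP/(_ u) := rho_theta repC x y.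
  rewrite !add_lfunE opp_lfunE !comp_lfunE => <-.
  by rewrite subrK.
Qed.

Definition pair_of_cm : strict2LieDer F := Strict2LieDer lie2_of_cm_derivation.

End PairOfCrossedModule.

(** * Comparison of the notions of equivalence *)

Section Comparison.
Variable F : fieldType.

(** The condition on the bracket of [A] follows from the one on [rho] and the
    Peiffer identity, so what remains are the conditions of a strict isomorphism. *)
Lemma corresponds_pair_of_cm (S : strict2LieDer F) (C : crossedModule F) :
  corresponds S C <-> strictly_isomorphic S (pair_of_cm C).
Proof.
split.
- case=> g0 [g1 [[b0 b1] gd [gX0 gX1] [g000 _] g001]].
  by exists g0, g1; split.
- case=> g0 [g1 [b0 b1 gd g000 g001 gX0 gX1]].
  exists g0, g1; split=> //; split=> // u v w.
  have /lfun_compP gdE := gd.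
  by rewrite g001 !gdE /= cm_peiffer.
Qed.

Lemma conj_lfunP (U V : vectType F) (t : 'Hom(U, V)) (f : 'End(U)) (g : 'End(V)) :
  bijective t -> (t \o f \o t^-1)%VF = g <-> forall u, t (f u) = g (t u).
Proof.
move=> /lfun_bijK [tK sK]; rewrite lfun_eqP; split=> tf u.
  by rewrite -tf !comp_lfunE tK.
by rewrite !comp_lfunE tf sK.
Qed.

(** In the backward direction [tau] preserves the bracket of [A] because the
    Peiffer identity expresses it through [rho] and [eta], both of which are
    preserved. *)
Lemma cm_equivalent_pair_of_cm (C C' : crossedModule F) :
  cm_equivalent C C' <-> strictly_isomorphic (pair_of_cm C) (pair_of_cm C').
Proof.
split.
- case=> s [t [[[s000 sth] bs] [[t000 tth] bt] st rst]].
  exists s, t; split=> // x y u.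
  by have /conj_lfunP-/(_ bt) := rst x y; apply.
- case=> s [t [bs bt st s000 s001 sth tth]].
  have /lfun_compP stE := st.
  exists s, t; split=> //; last by move=> x y; apply/conj_lfunP=> // u; apply: s001.
  split=> //; split=> // u v w.
  by rewrite -!cm_peiffer -!stE; apply: s001.
Qed.

End Comparison.

(** * From strict 3-Lie2Der pairs to crossed modules *)

Section CrossedModuleOfPair.
Variables (F : fieldType) (S : strict2LieDer F).
Local Notation d := (dd S).

Lemma l100E u x y : @l100 F S u x y = l001 x y u.
Proof. by rewrite l001_skew23 l010_skew12 opprK. Qed.

Lemma l010E x u y : @l010 F S x u y = - l001 x y u.
Proof. by rewrite l001_skew23 opprK. Qed.

(** This is [s2l_c] with a single mixed component, and the source of the
    skew-symmetry of the bracket on [V_1] in its last two arguments. *)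
Lemma l001_dd_swap x u v : @l001 F S x (d u) v = - l001 x (d v) u.
Proof.
have := s2l_c u v x; rewrite l100E l010E => c.
by rewrite l001_skew12 c l001_skew12.
Qed.

(** With a single mixed component, [s2l_f] becomes the composition rule of a
    representation. *)
Lemma l001_comp x1 x2 x3 x4 (u : V1 S) :
  l001 x1 x2 (l001 x3 x4 u) =
    l001 (l000 x1 x2 x3) x4 u + l001 x3 (l000 x1 x2 x4) u
    + l001 x3 x4 (l001 x1 x2 u).
Proof.
have := s2l_f x1 x2 u x3 x4; rewrite !l100E => /esym/subr0_eq <-.
by rewrite [RHS]addrC addrA.
Qed.

(** Likewise [s2l_e] becomes the expansion of a representation on a bracket. *)
Lemma l001_l000 x1 x2 x3 x4 (u : V1 S) :
  l001 x1 (l000 x2 x3 x4) u =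
    l001 x3 x4 (l001 x1 x2 u) - l001 x2 x4 (l001 x1 x3 u)
    + l001 x2 x3 (l001 x1 x4 u).
Proof.
by have := s2l_e u x1 x2 x3 x4; rewrite !l100E !l010E => /esym/subr0_eq <-.
Qed.

Definition base_lie : threeLie F.
Proof.
refine (@ThreeLie F (V0 S) (fun x y z => l000 x y z) _ _ _ _).
- exact: l000_trilinear.
- exact: l000_skew12.
- exact: l000_skew23.
- by move=> x1 x2 x3 x4 x5; have /esym/subr0_eq <- := s2l_d x1 x2 x3 x4 x5.
Defined.

Definition base_lieder : threeLieDer F :=
  @ThreeLieDer F base_lie (X0 S) (s2d_000 (s2ld_derivation S)).

Definition fibre_bracket (u v w : V1 S) : V1 S := l001 (d u) (d v) w.

Lemma dd_fibre_bracket u v w :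
  d (fibre_bracket u v w) = l000 (d u) (d v) (d w).
Proof. exact: s2l_a. Qed.

(** The fundamental identity for the bracket [l001 (d u) (d v) w] is the
    composition rule [l001_comp] at elements of the form [d u], because [d] maps
    this bracket to the one of [V_0]. *)
Definition fibre_lie : threeLie F.
Proof.
refine (@ThreeLie F (V1 S) fibre_bracket _ _ _ _).
- have [lx ly lu] := l001_trilinear S.
  split=> [v w|u w|u v] a z z'; rewrite /fibre_bracket ?linearP.
  + exact: lx.
  + exact: ly.
  + exact: lu.
- by move=> u v w; apply: l001_skew12.
- by move=> u v w; apply: l001_dd_swap.
- move=> u1 u2 u3 u4 u5; rewrite {1 2}/fibre_bracket l001_comp.
  by rewrite /fibre_bracket !s2l_a.
Defined.

Lemma fibre_derivation : @is_derivation F fibre_lie (X1 S).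
Proof.
have [/lfun_compP dX _ X001] := s2ld_derivation S.
by move=> u v w; rewrite /= /fibre_bracket X001 !dX.
Qed.

Definition fibre_lieder : threeLieDer F := ThreeLieDer fibre_derivation.

Definition base_action (x y : V0 S) : 'End(V1 S) := linfun (l001 x y).

Lemma base_actionE x y : base_action x y =1 l001 x y.
Proof. by have [_ _ lu] := l001_trilinear S; apply: linfun_linearE. Qed.

Lemma base_action_representation :
  @is_representation F base_lieder (V1 S) base_action (X1 S).
Proof.
have [lx ly _] := l001_trilinear S.
have [_ _ X001] := s2ld_derivation S.
split=> /=.
- move=> y a x x'; apply/lfunP => u.
  by rewrite add_lfunE scale_lfunE !base_actionE lx.
- move=> x a y y'; apply/lfunP => u.
  by rewrite add_lfunE scale_lfunE !base_actionE ly.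
- by move=> x y; apply/lfunP=> u; rewrite opp_lfunE !base_actionE l001_skew12.
- move=> x1 x2 x3 x4; apply/lfunP => u.
  by rewrite !(add_lfunE, comp_lfunE) !base_actionE l001_comp.
- move=> x1 x2 x3 x4; apply/lfunP => u.
  by rewrite !(add_lfunE, opp_lfunE, comp_lfunE) !base_actionE l001_l000.
- move=> x y; apply/lfunP => u.
  by rewrite !(add_lfunE, opp_lfunE, comp_lfunE) !base_actionE X001 addrK.
Qed.

(** The condition that [rho x y] is a derivation of the bracket of [A] is again
    [l001_comp], with the last two acting elements in the image of [d]. *)
Definition cm_of_pair : crossedModule F.
Proof.
refine (@CrossedModule F fibre_lieder base_lieder base_action (dd S)
  base_action_representation _ _ _ _ _).
- split=> [u v w|]; first exact: dd_fibre_bracket.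
  by have [dX _ _] := s2ld_derivation S; rewrite /= dX.
- by move=> x y u; rewrite base_actionE; apply: s2l_a.
- by move=> u v w; rewrite base_actionE.
- by move=> x u v; rewrite !base_actionE; apply: l001_dd_swap.
- move=> x y u v w; rewrite /= !base_actionE /fibre_bracket.
  by rewrite l001_comp !s2l_a.
Defined.

(** The identity maps are an isomorphism: [cm_of_pair] keeps the data of the
    pair and only repackages [l001 x y] as an element of ['End(V1 S)]. *)
Lemma pair_of_cm_of_pair : strictly_isomorphic S (pair_of_cm cm_of_pair).
Proof.
exists \1%VF, \1%VF; split; rewrite ?comp_lfun1l ?comp_lfun1r //.
- by exists id => x; rewrite id_lfunE.
- by exists id => x; rewrite id_lfunE.
- by move=> x y z; rewrite !id_lfunE.
- by move=> x y u; rewrite !id_lfunE /= base_actionE.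
Qed.

End CrossedModuleOfPair.

(** * The correspondence *)

Theorem theorem5p2 (F : closedFieldType) (charF0 : [pchar F] =i pred0) :
  exists Phi : strict_iso_class F -> crossed_module_class F,
    bijective Phi /\
    forall (S : strict2LieDer F) (C : crossedModule F),
      Phi (class_of (@strictly_isomorphic F) S) = class_of (@cm_equivalent F) C
      <-> corresponds S C.
Proof.
have [Phi [bPhi PhiE]] := class_bijection
  (@strictly_isomorphic_refl F) (@strictly_isomorphic_sym F)
  (@strictly_isomorphic_trans F) (@cm_equivalent_pair_of_cm F)
  (fun S => ex_intro _ (cm_of_pair S) (pair_of_cm_of_pair S)).
exists Phi; split=> // S C.
by split=> [/PhiE/corresponds_pair_of_cm|/corresponds_pair_of_cm/PhiE].
Qed.
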